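(* Let $(\phi_t)$ be a non-elliptic semigroup in $\mathbb{D}$ with Denjoy-Wolff point $\tau\in\partial\mathbb{D}$ and tangential speed $v^T(t)$. Then the orbit $[0,+\infty)\ni t\mapsto \phi_t(z)$ converges non-tangentially to $\tau$ for some (and hence any) $z\in\mathbb{D}$ if and only if $\limsup_{t\to+\infty}v^T(t)<+\infty$.
   Context: Let $\mathbb{D}=\{\zeta\in\mathbb{C}:|\zeta|<1\}$ with hyperbolic distance $\omega(z,w)=\frac12\log\frac{1+|T_z(w)|}{1-|T_z(w)|}$, $T_z(w)=\frac{z-w}{1-\overline{z}w}$. A non-elliptic semigroup in $\mathbb{D}$ is a family $(\phi_t)_{t\ge0}$ of holomorphic maps $\phi_t:\mathbb{D}\to\mathbb{D}$ such that $\phi_0=\mathrm{id}$, $\phi_{t+s}=\phi_t\circ\phi_s$ for all $s,t\ge0$, $t\mapsto\phi_t$ is continuous for the topology of uniform convergence on compacta of $\mathbb{D}$, and $\phi_t$ has no fixed point in $\mathbb{D}$ for $t>0$. Its Denjoy-Wolff point is the unique $\tau\in\partial\mathbb{D}$ such that $\lim_{t\to\infty}\phi_t(z)=\tau$ for all $z\in\mathbb{D}$. Let $\gamma:(-1,1)\to\mathbb{D}$, $\gamma(r)=r\tau$ (a geodesic), and for $z\in\mathbb{D}$ let $\pi_\gamma(z)$ be the unique point of $\gamma((-1,1))$ closest to $z$ with respect to $\omega$. The tangential speed is $v^T(t):=\omega(\phi_t(0),\pi_\gamma(\phi_t(0)))$, $t\ge0$. A curve $\eta:[0,+\infty)\to\mathbb{D}$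 converging to $\tau\in\partial\mathbb{D}$ converges non-tangentially if $\frac{|\tau-\eta(t)|}{1-|\eta(t)|}$ is bounded for $t$ large. *)

(* Defs.v *)
From Stdlib Require Import Reals List.
From Coquelicot Require Import Coquelicot.
Open Scope R_scope.

Definition unit_disc (z : C) : Prop := Cmod z < 1.

Definition mobius (z w : C) : C := ((z - w) / (1 - Cconj z * w))%C.

Definition hyp_dist (z w : C) : R :=
  / 2 * ln ((1 + Cmod (mobius z w)) / (1 - Cmod (mobius z w))).

(* [ex_derive] at type [C -> C] is complex differentiability. The disc being
   open, values of [f] outside it are irrelevant. *)
Definition holomorphic_self_map (f : C -> C) : Prop :=
  forall z : C, unit_disc z -> unit_disc (f z) /\ ex_derive f z.

Definition compact_subset {T : UniformSpace} (K : T -> Prop) : Prop :=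
  forall (I : Type) (U : I -> T -> Prop),
    (forall i, open (U i)) ->
    (forall x, K x -> exists i, U i x) ->
    exists l : list I, forall x, K x -> exists i, In i l /\ U i x.

(* Only [phi t z] for [0 <= t] and [z] in the disc is meaningful; every
   condition below is relativized accordingly. *)
Record non_elliptic_semigroup (phi : R -> C -> C) : Prop := {
  sg_holomorphic :
    forall t, 0 <= t -> holomorphic_self_map (phi t);
  sg_zero :
    forall z, unit_disc z -> phi 0 z = z;
  sg_add :
    forall s t z, 0 <= s -> 0 <= t -> unit_disc z ->
      phi (t + s) z = phi t (phi s z);
  sg_continuous :
    forall (t0 : R) (K : C -> Prop), 0 <= t0 ->
      compact_subset K -> (forall z, K z -> unit_disc z) ->
      forall eps : posreal,
        within (fun t => 0 <= t) (locally t0)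
          (fun t => forall z, K z -> Cmod (phi t z - phi t0 z) < eps);
  sg_no_fixed_point :
    forall t z, 0 < t -> unit_disc z -> phi t z <> z
}.

Definition Denjoy_Wolff_point (phi : R -> C -> C) (tau : C) : Prop :=
  Cmod tau = 1 /\
  forall z, unit_disc z ->
    filterlim (fun t => phi t z) (Rbar_locally p_infty) (locally tau).

(* The image of the geodesic r |-> r tau, -1 < r < 1. *)
Definition geodesic (tau p : C) : Prop :=
  exists r : R, -1 < r < 1 /\ p = (RtoC r * tau)%C.

Definition closest_on_geodesic (tau z p : C) : Prop :=
  geodesic tau p /\
  forall q, geodesic tau q -> hyp_dist z p <= hyp_dist z q.

(* [iota P] is the point satisfying [P] when exactly one such point exists. *)
Definition geodesic_proj (tau z : C) : C :=
  iota (T := C_CompleteNormedModule) (closest_on_geodesic tau z).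

Definition tangential_speed (phi : R -> C -> C) (tau : C) (t : R) : R :=
  hyp_dist (phi t 0) (geodesic_proj tau (phi t 0)).

(* limsup of f at +oo, i.e. inf over T of sup over t >= T, in Rbar. *)
Definition LimSup_p_infty (f : R -> R) : Rbar :=
  Rbar_glb (fun y => exists T : R,
    y = Lub_Rbar (fun x => exists t, T <= t /\ x = f t)).

Definition converges_non_tangentially (eta : R -> C) (tau : C) : Prop :=
  filterlim eta (Rbar_locally p_infty) (locally tau) /\
  exists M : R,
    Rbar_locally p_infty
      (fun t => Cmod (tau - eta t) / (1 - Cmod (eta t)) <= M).

(* Main.v *)
Require Import Defs.
From Stdlib Require Import Reals Lra Psatz Classical ClassicalEpsilon.
From Coquelicot Require Import Coquelicot.
Open Scope R_scope.

(** Two facts carry the theorem.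

    Non-tangential convergence of an orbit to tau means that the quotient
    |tau - w| / (1 - |w|) stays bounded along the orbit, that is, that the orbit
    ends in a Stolz region. Near tau, Stolz regions and hyperbolic neighbourhoods
    of the geodesic (-tau, tau) are the same thing: a point w of a Stolz region
    is at bounded hyperbolic distance from |w| tau, hence from its projection
    ([stolz_dist_proj_bounded]); conversely the quotient is 1 at r tau for
    0 <= r < 1, and it changes in a controlled way under a displacement of
    bounded hyperbolic length ([nontangential_transfer],
    [dist_proj_bounded_stolz]). For this the projection must exist and be unique
    ([closest_on_geodesic_unique]), which is an explicit minimization. Applied to
    w = phi_t(0), this is the equivalence for the orbit of 0
    ([non_tangential_iff_tangential_speed]).

    The orbit of another point z stays at bounded hyperbolic distance from the
    orbit of 0, because phi_t does not increase hyperbolic distances to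
    0 ([schwarz_pick]); by [nontangential_transfer] again, the two orbits converge
    non-tangentially together ([non_tangential_iff_orbit_0]).

    The Schwarz-Pick inequality is derived from complex differentiability alone.
    Goursat's bisection argument ([goursat]), applied in logarithmic polar
    coordinates, gives the mean value property ([mean_value]) for functions that
    are differentiable off the centre and continuous there. If Re f exceeded its
    boundary values inside a disc, then Re f + eps |w|^2 would have an interior
    maximum c for small eps > 0; absorbing the linear part of |w|^2 at c into f
    would contradict the mean value property ([no_quadratic_peak],
    [maximum_principle]). The Schwarz lemma is the maximum principle for
    h(w) / w, whose singularity at 0 is covered by the weakened hypothesis. *)

(** * Bisection of rectangles *)

Lemma nested_intervals_common_point (a b : nat -> R) :
  (forall n, a n <= a (S n)) -> (forall n, b (S n) <= b n) ->
  (forall n, a n <= b n) ->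
  exists p, forall n, a n <= p <= b n.
Proof.
intros Ha Hb Hab.
assert (Ha' : forall n k, a n <= a (n + k)%nat).
{ intros n k; induction k as [|k IH].
  - rewrite Nat.add_0_r; lra.
  - rewrite Nat.add_succ_r; specialize (Ha (n + k)%nat); lra. }
assert (Hb' : forall n k, b (n + k)%nat <= b n).
{ intros n k; induction k as [|k IH].
  - rewrite Nat.add_0_r; lra.
  - rewrite Nat.add_succ_r; specialize (Hb (n + k)%nat); lra. }
assert (Hcross : forall n k, a n <= b k).
{ intros n k.
  specialize (Ha' n k); specialize (Hb' k n); specialize (Hab (n + k)%nat).
  rewrite (Nat.add_comm k n) in Hb'; lra. }
destruct (completeness (fun x => exists n, x = a n)) as [p [Hub Hlub]].
- exists (b 0%nat); intros x [n ->]; apply Hcross.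
- exists (a 0%nat), 0%nat; reflexivity.
- exists p; intros n; split.
  + apply Hub; now exists n.
  + apply Hlub; intros x [k ->]; apply Hcross.
Qed.

(** A property of rectangles [a, b] x [c, d] that passes from the four quarters
    to the whole, and holds for all small rectangles around each point, holds
    for the whole rectangle. *)
Lemma rectangle_bisection (P : R -> R -> R -> R -> Prop) (a b c d : R) :
  a <= b -> c <= d ->
  (forall a' b' c' d',
     a <= a' -> a' <= b' -> b' <= b -> c <= c' -> c' <= d' -> d' <= d ->
     let m := (a' + b') / 2 in let n := (c' + d') / 2 in
     P a' m c' n -> P m b' c' n -> P a' m n d' -> P m b' n d' ->
     P a' b' c' d') ->
  (forall p q, a <= p <= b -> c <= q <= d ->
     exists delta, 0 < delta /\
       forall a' b' c' d',
         a <= a' -> a' <= p <= b' -> b' <= b ->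
         c <= c' -> c' <= q <= d' -> d' <= d ->
         b' - a' < delta -> d' - c' < delta -> P a' b' c' d') ->
  P a b c d.
Proof.
intros Hab Hcd Hsplit Hloc.
apply NNPP; intros Hnot.
set (bad := fun t : R * R * R * R =>
  let '(a', b', c', d') := t in
  a <= a' /\ a' <= b' /\ b' <= b /\ c <= c' /\ c' <= d' /\ d' <= d /\
  ~ P a' b' c' d').
set (half := fun t u : R * R * R * R =>
  let '(a1, b1, c1, d1) := t in
  let '(a2, b2, c2, d2) := u in
  a1 <= a2 /\ b2 <= b1 /\ c1 <= c2 /\ d2 <= d1 /\
  b2 - a2 = (b1 - a1) / 2 /\ d2 - c2 = (d1 - c1) / 2).
assert (Hstep : forall t : {t | bad t}, exists u : {u | bad u},
          half (proj1_sig t) (proj1_sig u)).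
{ intros [[[[a1 b1] c1] d1] Hbad].
  pose proof Hbad as (H1 & H2 & H3 & H4 & H5 & H6 & H7).
  set (m := (a1 + b1) / 2); set (n := (c1 + d1) / 2).
  apply NNPP; intros Hno.
  apply H7; apply Hsplit; try assumption; apply NNPP; intros Hq; apply Hno.
  - assert (Hb : bad (a1, m, c1, n)) by (unfold bad, m, n in *; repeat split; try lra; exact Hq).
    exists (exist _ _ Hb); simpl; unfold m, n; lra.
  - assert (Hb : bad (m, b1, c1, n)) by (unfold bad, m, n in *; repeat split; try lra; exact Hq).
    exists (exist _ _ Hb); simpl; unfold m, n; lra.
  - assert (Hb : bad (a1, m, n, d1)) by (unfold bad, m, n in *; repeat split; try lra; exact Hq).
    exists (exist _ _ Hb); simpl; unfold m, n; lra.
  - assert (Hb : bad (m, b1, n, d1)) by (unfold bad, m, n in *; repeat split; try lra; exact Hq).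
    exists (exist _ _ Hb); simpl; unfold m, n; lra. }
(* Repeated choice of a bad quarter produces bad rectangles shrinking to a
   point (p, q); but no small rectangle around that point is bad. *)
set (step := fun t => proj1_sig (constructive_indefinite_description _ (Hstep t))).
assert (Hbad0 : bad (a, b, c, d)) by (simpl; repeat split; try lra; exact Hnot).
set (sq := fun n => Nat.iter n step (exist _ _ Hbad0)).
set (sa := fun n => fst (fst (fst (proj1_sig (sq n))))).
set (sb := fun n => snd (fst (fst (proj1_sig (sq n))))).
set (sc := fun n => snd (fst (proj1_sig (sq n)))).
set (sd := fun n => snd (proj1_sig (sq n))).
assert (Hin : forall n, a <= sa n /\ sa n <= sb n /\ sb n <= b /\
          c <= sc n /\ sc n <= sd n /\ sd n <= d /\
          ~ P (sa n) (sb n) (sc n) (sd n)).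
{ intros n; unfold sa, sb, sc, sd.
  destruct (sq n) as [[[[a1 b1] c1] d1] H]; exact H. }
assert (Hhalf : forall n, sa n <= sa (S n) /\ sb (S n) <= sb n /\
          sc n <= sc (S n) /\ sd (S n) <= sd n /\
          sb (S n) - sa (S n) = (sb n - sa n) / 2 /\
          sd (S n) - sc (S n) = (sd n - sc n) / 2).
{ intros n.
  pose proof (proj2_sig (constructive_indefinite_description _ (Hstep (sq n)))) as H.
  change (half (proj1_sig (sq n)) (proj1_sig (sq (S n)))) in H.
  unfold sa, sb, sc, sd.
  destruct (sq n) as [[[[a1 b1] c1] d1] H1].
  destruct (sq (S n)) as [[[[a2 b2] c2] d2] H2].
  exact H. }
destruct (nested_intervals_common_point sa sb) as [p Hp];
  try (intros n; generalize (Hin n) (Hhalf n); intuition; fail).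
destruct (nested_intervals_common_point sc sd) as [q Hq];
  try (intros n; generalize (Hin n) (Hhalf n); intuition; fail).
assert (Hlen : forall n, sb n - sa n = (b - a) * (/ 2) ^ n /\
                         sd n - sc n = (d - c) * (/ 2) ^ n).
{ induction n as [|n [IH1 IH2]].
  - unfold sa, sb, sc, sd; simpl; lra.
  - destruct (Hhalf n) as (_ & _ & _ & _ & -> & ->).
    rewrite IH1, IH2; simpl; lra. }
destruct (Hloc p q) as [delta [Hd HP]].
- specialize (Hp 0%nat); unfold sa, sb in Hp; simpl in Hp; lra.
- specialize (Hq 0%nat); unfold sc, sd in Hq; simpl in Hq; lra.
- set (L := (b - a) + (d - c) + 1).
  assert (HL : 0 < L) by (unfold L; lra).
  destruct (pow_lt_1_zero (/ 2)) with (y := delta / L) as [N HN].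
  + rewrite Rabs_pos_eq; lra.
  + now apply Rdiv_lt_0_compat.
  + specialize (HN N (le_n N)).
    assert (H2 : 0 < (/ 2) ^ N) by (apply pow_lt; lra).
    rewrite Rabs_pos_eq in HN by lra.
    apply (Rmult_lt_compat_l L) in HN; [|exact HL].
    replace (L * (delta / L)) with delta in HN by (field; lra).
    destruct (Hlen N) as [E1 E2].
    destruct (Hin N) as (I1 & I2 & I3 & I4 & I5 & I6 & I7).
    apply I7, HP; auto; unfold L in HN; nra.
Qed.

(** * Goursat's theorem *)

(** The integral of the form P dx + Q dy along the counterclockwise boundary of
    [a, b] x [c, d]. *)
Definition boundary_integral (P Q : R -> R -> R) (a b c d : R) : R :=
  RInt (fun x => P x c) a b + RInt (fun y => Q b y) c d
  - RInt (fun x => P x d) a b - RInt (fun y => Q a y) c d.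

Lemma differentiable_pt_lim_section_l (f : R -> R -> R) (x y lx ly : R) :
  differentiable_pt_lim f x y lx ly -> continuous (fun u => f u y) x.
Proof.
intros H; apply (ex_derive_continuous (K := R_AbsRing) (V := R_NormedModule)).
exists (lx * 1 + ly * 0); apply is_derive_Reals.
apply (derivable_pt_lim_comp_2d f (fun u => u) (fun _ => y)); trivial.
- apply derivable_pt_lim_id.
- apply derivable_pt_lim_const.
Qed.

Lemma differentiable_pt_lim_section_r (f : R -> R -> R) (x y lx ly : R) :
  differentiable_pt_lim f x y lx ly -> continuous (fun v => f x v) y.
Proof.
intros H; apply (ex_derive_continuous (K := R_AbsRing) (V := R_NormedModule)).
exists (lx * 0 + ly * 1); apply is_derive_Reals.
apply (derivable_pt_lim_comp_2d f (fun _ => x) (fun v => v)); trivial.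
- apply derivable_pt_lim_const.
- apply derivable_pt_lim_id.
Qed.

Lemma RInt_near_const (f : R -> R) (a b e M : R) :
  a <= b -> ex_RInt f a b ->
  (forall x, a <= x <= b -> Rabs (f x - e) <= M) ->
  Rabs (RInt f a b - (b - a) * e) <= (b - a) * M.
Proof.
intros Hab Hf HM.
replace ((b - a) * e) with (RInt (fun _ => e) a b)
  by (rewrite RInt_const; reflexivity).
change (RInt f a b - RInt (fun _ : R => e) a b)
  with (minus (RInt f a b) (RInt (fun _ : R => e) a b)).
rewrite <- RInt_minus; [|exact Hf|apply ex_RInt_const].
apply abs_RInt_le_const; trivial.
apply (ex_RInt_minus (V := R_NormedModule)); [exact Hf|apply ex_RInt_const].
Qed.

(** A form P dx + Q dy with dP/dy = dQ/dx at every point of a rectangle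
    integrates to zero along its boundary; the partial derivatives need not be
    continuous. *)
Theorem goursat (P Q : R -> R -> R) (a b c d : R) :
  a <= b -> c <= d ->
  (forall x y, a <= x <= b -> c <= y <= d ->
     exists px e qy, differentiable_pt_lim P x y px e /\
                     differentiable_pt_lim Q x y e qy) ->
  boundary_integral P Q a b c d = 0.
Proof.
intros Hab Hcd Hdiff.
assert (IP : forall u v y, a <= u <= b -> a <= v <= b -> c <= y <= d ->
          ex_RInt (fun x => P x y) u v).
{ intros u v y Hu Hv Hy.
  apply (ex_RInt_continuous (V := R_CompleteNormedModule)); intros z Hz.
  destruct (Hdiff z y) as (px & e & qy & H & _); trivial.
  - revert Hz; apply Rmin_case_strong; apply Rmax_case_strong; lra.
  - now apply differentiable_pt_lim_section_l in H. }
assert (IQ : forall u v x, c <= u <= d -> c <= v <= d -> a <= x <= b ->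
          ex_RInt (fun y => Q x y) u v).
{ intros u v x Hu Hv Hx.
  apply (ex_RInt_continuous (V := R_CompleteNormedModule)); intros z Hz.
  destruct (Hdiff x z) as (px & e & qy & _ & H); trivial.
  - revert Hz; apply Rmin_case_strong; apply Rmax_case_strong; lra.
  - now apply differentiable_pt_lim_section_r in H. }
assert (Hsmall : forall eps : posreal,
  Rabs (boundary_integral P Q a b c d) <= 2 * eps * (b - a + (d - c)) ^ 2).
{ intros eps.
  apply (rectangle_bisection (fun a b c d =>
    Rabs (boundary_integral P Q a b c d) <= 2 * eps * (b - a + (d - c)) ^ 2));
    trivial.
  - intros a' b' c' d' H1 H2 H3 H4 H5 H6 m n K1 K2 K3 K4.
    assert (Hm : a' <= m <= b') by (unfold m; lra).
    assert (Hn : c' <= n <= d') by (unfold n; lra).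
    replace (boundary_integral P Q a' b' c' d') with
      (boundary_integral P Q a' m c' n + boundary_integral P Q m b' c' n +
       (boundary_integral P Q a' m n d' + boundary_integral P Q m b' n d')).
    + replace (b' - a') with (2 * (m - a')) by (unfold m; lra).
      replace (d' - c') with (2 * (n - c')) by (unfold n; lra).
      replace (b' - m) with (m - a') in * by (unfold m; lra).
      replace (d' - n) with (n - c') in * by (unfold n; lra).
      set (s := m - a' + (n - c')) in *.
      replace (2 * (m - a') + 2 * (n - c')) with (2 * s) by (unfold s; ring).
      eapply Rle_trans; [apply Rabs_triang|].
      eapply Rle_trans; [apply Rplus_le_compat; apply Rabs_triang|].
      lra.
    + assert (CP : forall y, c' <= y <= d' ->
        RInt (fun x => P x y) a' m + RInt (fun x => P x y) m b'
        = RInt (fun x => P x y) a' b').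
      { intros y Hy; apply (RInt_Chasles (V := R_CompleteNormedModule));
        apply IP; lra. }
      assert (CQ : forall x, a' <= x <= b' ->
        RInt (fun y => Q x y) c' n + RInt (fun y => Q x y) n d'
        = RInt (fun y => Q x y) c' d').
      { intros x Hx; apply (RInt_Chasles (V := R_CompleteNormedModule));
        apply IQ; lra. }
      pose proof (CP c' ltac:(lra)); pose proof (CP d' ltac:(lra)).
      pose proof (CQ a' ltac:(lra)); pose proof (CQ b' ltac:(lra)).
      unfold boundary_integral; lra.
  - intros p q Hp Hq.
    destruct (Hdiff p q Hp Hq) as (px & e & qy & HP & HQ).
    destruct (HP eps) as [d1 H1]; destruct (HQ eps) as [d2 H2].
    exists (Rmin d1 d2); split; [apply Rmin_glb_lt; apply cond_pos|].
    intros a' b' c' d' A1 A2 A3 B1 B2 B3 HA HB.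
    pose proof (Rmin_l d1 d2); pose proof (Rmin_r d1 d2).
    pose proof (cond_pos eps) as Heps.
    set (s := b' - a' + (d' - c')).
    assert (EP : forall x y, a' <= x <= b' -> c' <= y <= d' ->
      Rabs (P x y - P p q - (px * (x - p) + e * (y - q))) <= eps * s).
    { intros x y Hx Hy.
      assert (Rabs (x - p) <= b' - a') by (apply Rabs_le; lra).
      assert (Rabs (y - q) <= d' - c') by (apply Rabs_le; lra).
      eapply Rle_trans; [apply H1; lra|].
      apply Rmult_le_compat_l; [lra|unfold s; apply Rmax_lub; lra]. }
    assert (EQ : forall x y, a' <= x <= b' -> c' <= y <= d' ->
      Rabs (Q x y - Q p q - (e * (x - p) + qy * (y - q))) <= eps * s).
    { intros x y Hx Hy.
      assert (Rabs (x - p) <= b' - a') by (apply Rabs_le; lra).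
      assert (Rabs (y - q) <= d' - c') by (apply Rabs_le; lra).
      eapply Rle_trans; [apply H2; lra|].
      apply Rmult_le_compat_l; [lra|unfold s; apply Rmax_lub; lra]. }
    (* The linear parts contribute (b' - a') e (c' - d') and
       (d' - c') e (b' - a'), which cancel. *)
    assert (TP : Rabs (RInt (fun x => minus (P x c') (P x d')) a' b'
                       - (b' - a') * (e * (c' - d'))) <= (b' - a') * (2 * eps * s)).
    { apply RInt_near_const; [lra| |].
      - apply (ex_RInt_minus (V := R_NormedModule)); apply IP; lra.
      - intros x Hx.
        pose proof (EP x c' Hx ltac:(lra)) as E1; pose proof (EP x d' Hx ltac:(lra)) as E2.
        apply Rabs_le_between in E1; apply Rabs_le_between in E2.
        change (minus (P x c') (P x d')) with (P x c' - P x d').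
        apply Rabs_le; lra. }
    assert (TQ : Rabs (RInt (fun y => minus (Q b' y) (Q a' y)) c' d'
                       - (d' - c') * (e * (b' - a'))) <= (d' - c') * (2 * eps * s)).
    { apply RInt_near_const; [lra| |].
      - apply (ex_RInt_minus (V := R_NormedModule)); apply IQ; lra.
      - intros y Hy.
        pose proof (EQ b' y ltac:(lra) Hy) as E1; pose proof (EQ a' y ltac:(lra) Hy) as E2.
        apply Rabs_le_between in E1; apply Rabs_le_between in E2.
        change (minus (Q b' y) (Q a' y)) with (Q b' y - Q a' y).
        apply Rabs_le; lra. }
    assert (MP : RInt (fun x => minus (P x c') (P x d')) a' b'
      = RInt (fun x => P x c') a' b' - RInt (fun x => P x d') a' b')
      by (apply (RInt_minus (V := R_CompleteNormedModule)); apply IP; lra).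
    assert (MQ : RInt (fun y => minus (Q b' y) (Q a' y)) c' d'
      = RInt (fun y => Q b' y) c' d' - RInt (fun y => Q a' y) c' d')
      by (apply (RInt_minus (V := R_CompleteNormedModule)); apply IQ; lra).
    rewrite MP in TP; rewrite MQ in TQ.
    apply Rabs_le_between in TP; apply Rabs_le_between in TQ.
    unfold boundary_integral; fold s.
    replace (2 * eps * s ^ 2) with ((b' - a') * (2 * eps * s) + (d' - c') * (2 * eps * s))
      by (unfold s; ring).
    apply Rabs_le; lra. }
apply NNPP; intros Hne; apply Rabs_pos_lt in Hne.
set (S := 2 * (b - a + (d - c)) ^ 2 + 1).
assert (HS : 0 < S) by (unfold S; nra).
set (J := Rabs (boundary_integral P Q a b c d)) in *.
assert (He : 0 < J / (2 * S)) by (apply Rdiv_lt_0_compat; lra).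
specialize (Hsmall (mkposreal _ He)); simpl in Hsmall.
assert (E : J / (2 * S) * S = J / 2) by (field; lra).
unfold S in *; nra.
Qed.

(** * Complex differentiability *)

Lemma is_derive_C_iff (f : C -> C) (z l : C) :
  is_derive (K := C_AbsRing) (V := C_NormedModule) f z l <->
  forall eps, 0 < eps -> exists delta, 0 < delta /\
    forall w, Cmod (w - z) < delta ->
      Cmod (f w - f z - l * (w - z)) <= eps * Cmod (w - z).
Proof.
split.
- intros [_ H] eps Heps.
  destruct (H z (fun P HP => HP) (mkposreal _ Heps)) as [delta Hd].
  exists delta; split; [apply cond_pos|].
  intros w Hw; specialize (Hd w Hw).
  replace (l * (w - z))%C with ((w - z) * l)%C by ring.
  exact Hd.
- intros H; split.
  + apply is_linear_scal_l.
  + intros x Hx eps.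
    assert (E : z = x) by exact (is_filter_lim_locally_unique (V := AbsRing_NormedModule C_AbsRing) z x Hx).
    subst x.
    destruct (H eps (cond_pos eps)) as (delta & Hd & HH).
    exists (mkposreal _ Hd); intros w Hw.
    specialize (HH w Hw).
    replace (l * (w - z))%C with ((w - z) * l)%C in HH by ring.
    exact HH.
Qed.

(** Continuity at a point, expressed with the modulus. *)
Definition C_continuous (f : C -> C) (z : C) : Prop :=
  forall eps, 0 < eps -> exists delta, 0 < delta /\
    forall w, Cmod (w - z) < delta -> Cmod (f w - f z) < eps.

Lemma ex_derive_C_continuous (f : C -> C) (z : C) :
  ex_derive (K := C_AbsRing) (V := C_NormedModule) f z -> C_continuous f z.
Proof.
intros [l H] eps Heps.
destruct (proj1 (is_derive_C_iff f z l) H 1 Rlt_0_1) as (d & Hd & HH).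
assert (H0 := Cmod_ge_0 l).
exists (Rmin d (eps / (2 + Cmod l))); split.
- apply Rmin_glb_lt; trivial; apply Rdiv_lt_0_compat; lra.
- intros w Hw.
  assert (Hw1 : Cmod (w - z) < d) by (eapply Rlt_le_trans; [exact Hw|apply Rmin_l]).
  assert (Hw2 : Cmod (w - z) < eps / (2 + Cmod l))
    by (eapply Rlt_le_trans; [exact Hw|apply Rmin_r]).
  specialize (HH w Hw1).
  replace (f w - f z)%C with ((f w - f z - l * (w - z)) + l * (w - z))%C by ring.
  eapply Rle_lt_trans; [apply Cmod_triangle|].
  rewrite Cmod_mult.
  assert (E : eps / (2 + Cmod l) * (2 + Cmod l) = eps) by (field; lra).
  pose proof (Cmod_ge_0 (w - z)); nra.
Qed.

(** [C] carries two normed-module structures over itself, with the same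
    derivatives. *)
Lemma is_derive_C_AbsRing (f : C -> C) (z l : C) :
  is_derive (K := C_AbsRing) (V := C_NormedModule) f z l <->
  is_derive (K := C_AbsRing) (V := AbsRing_NormedModule C_AbsRing) f z l.
Proof.
split; intros [_ H]; (split; [apply is_linear_scal_l|]);
  intros x Hx eps; exact (H x Hx eps).
Qed.

Lemma ex_derive_Cmult (f g : C -> C) (z : C) :
  ex_derive (K := C_AbsRing) (V := C_NormedModule) f z ->
  ex_derive (K := C_AbsRing) (V := C_NormedModule) g z ->
  ex_derive (K := C_AbsRing) (V := C_NormedModule) (fun w => f w * g w)%C z.
Proof.
intros [lf Hf] [lg Hg]; exists (lf * g z + f z * lg)%C.
apply is_derive_C_AbsRing in Hf; apply is_derive_C_AbsRing in Hg.
apply is_derive_C_AbsRing.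
exact (is_derive_mult (K := C_AbsRing) f g z lf lg Hf Hg Cmult_comm).
Qed.

Lemma ex_derive_Ccomp (f g : C -> C) (z : C) :
  ex_derive (K := C_AbsRing) (V := C_NormedModule) f (g z) ->
  ex_derive (K := C_AbsRing) (V := C_NormedModule) g z ->
  ex_derive (K := C_AbsRing) (V := C_NormedModule) (fun w => f (g w)) z.
Proof.
intros [lf Hf] [lg Hg]; eexists.
apply is_derive_C_AbsRing in Hg.
exact (is_derive_comp (K := C_AbsRing) (V := C_NormedModule) f g z lf lg Hf Hg).
Qed.

Lemma ex_derive_Caffine (a b z : C) :
  ex_derive (K := C_AbsRing) (V := C_NormedModule) (fun w => a + b * w)%C z.
Proof.
exists b; apply is_derive_C_iff; intros eps Heps; exists 1; split; [lra|].
intros w _.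
replace (a + b * w - (a + b * z) - b * (w - z))%C with (RtoC 0) by ring.
rewrite Cmod_0; apply Rmult_le_pos; [lra|apply Cmod_ge_0].
Qed.

Lemma is_derive_Cinv (z : C) :
  z <> 0%C ->
  is_derive (K := C_AbsRing) (V := C_NormedModule) Cinv z (- / (z * z))%C.
Proof.
intros Hz; apply is_derive_C_iff; intros eps Heps.
assert (Hz' : 0 < Cmod z) by now apply Cmod_gt_0.
set (m := Cmod z) in *.
exists (Rmin (m / 2) (eps * (m * m * m) / 2)); split.
{ apply Rmin_glb_lt; [lra|].
  assert (0 < m * m) by nra. assert (0 < m * m * m) by nra. nra. }
intros w Hw.
assert (Hw1 : Cmod (w - z) < m / 2) by (eapply Rlt_le_trans; [exact Hw|apply Rmin_l]).
assert (Hw2 : Cmod (w - z) < eps * (m * m * m) / 2)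
  by (eapply Rlt_le_trans; [exact Hw|apply Rmin_r]).
assert (Hmw : m / 2 <= Cmod w).
{ assert (T := Cmod_triangle w (- (w - z))).
  replace (w + - (w - z))%C with z in T by ring.
  rewrite Cmod_opp in T; fold m in T; lra. }
assert (Hw0 : w <> 0%C) by (apply Cmod_gt_0; lra).
replace (/ w - / z - - / (z * z) * (w - z))%C
  with ((w - z) * (w - z) / (w * (z * z)))%C by (field; auto).
rewrite Cmod_div by (repeat apply Cmult_neq_0; auto).
rewrite !Cmod_mult; fold m.
set (t := Cmod (w - z)) in *; set (v := Cmod w) in *.
assert (Ht : 0 <= t) by apply Cmod_ge_0.
assert (Hmm : 0 < m * m) by nra.
apply (Rmult_le_reg_r (v * (m * m))); [nra|].
replace (t * t / (v * (m * m)) * (v * (m * m))) with (t * t)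
  by (field; split; lra).
replace (eps * t * (v * (m * m))) with (t * (eps * (v * (m * m)))) by ring.
apply Rmult_le_compat_l; trivial.
assert (m / 2 * (m * m) <= v * (m * m)) by (apply Rmult_le_compat_r; lra).
nra.
Qed.

(** The Cauchy-Riemann equations. *)
Lemma is_derive_C_Re_Im (f : C -> C) (x y : R) (l : C) :
  is_derive (K := C_AbsRing) (V := C_NormedModule) f (x, y) l ->
  differentiable_pt_lim (fun u v => Re (f (u, v))) x y (Re l) (- Im l) /\
  differentiable_pt_lim (fun u v => Im (f (u, v))) x y (Im l) (Re l).
Proof.
intros H; rewrite is_derive_C_iff in H.
assert (Hboth : forall eps : posreal, locally_2d (fun u v =>
  Cmod (f (u, v) - f (x, y) - l * ((u, v) - (x, y))) <=
    eps * Rmax (Rabs (u - x)) (Rabs (v - y))) x y).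
{ intros eps.
  assert (Hs : 0 < sqrt 2) by (apply sqrt_lt_R0; lra).
  destruct (H (eps / sqrt 2)) as (d & Hd & HH).
  { apply Rdiv_lt_0_compat; trivial; apply cond_pos. }
  assert (Hd2 : 0 < d / sqrt 2) by (apply Rdiv_lt_0_compat; trivial).
  exists (mkposreal _ Hd2); simpl; intros u v Hu Hv.
  assert (K := Cmod_2Rmax ((u, v) - (x, y))%C); simpl in K.
  change (u + - x) with (u - x) in K; change (v + - y) with (v - y) in K.
  set (M := Rmax (Rabs (u - x)) (Rabs (v - y))) in *.
  assert (HM : M < d / sqrt 2) by (apply Rmax_lub_lt; trivial).
  assert (E : d / sqrt 2 * sqrt 2 = d) by (field; lra).
  eapply Rle_trans; [apply HH; nra|].
  replace (eps * M) with (eps / sqrt 2 * (sqrt 2 * M)) by (field; lra).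
  apply Rmult_le_compat_l; trivial.
  apply Rlt_le, Rdiv_lt_0_compat; trivial; apply cond_pos. }
split; intros eps; destruct (Hboth eps) as [d Hd]; exists d;
  intros u v Hu Hv; (eapply Rle_trans; [|exact (Hd u v Hu Hv)]).
- eapply Rle_trans; [|apply re_le_Cmod].
  apply Req_le; f_equal.
  destruct (f (u, v)), (f (x, y)), l; simpl; ring.
- eapply Rle_trans; [|eapply Rle_trans; [apply Rmax_r|apply Rmax_Cmod]].
  apply Req_le; f_equal.
  destruct (f (u, v)), (f (x, y)), l; simpl; ring.
Qed.

(** * The mean value property *)

(** The point at polar coordinates (exp s, t) around c. *)
Definition polar (c : C) (s t : R) : C :=
  (Re c + exp s * cos t, Im c + exp s * sin t).

Lemma Cmod_polar (c : C) (s t : R) : Cmod (polar c s t - c) = exp s.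
Proof.
destruct c as [p q]; unfold polar, Cmod; simpl.
replace (_ + _) with (exp s * exp s * (Rsqr (sin t) + Rsqr (cos t)))
  by (unfold Rsqr; ring).
rewrite sin2_cos2, Rmult_1_r.
apply sqrt_square, Rlt_le, exp_pos.
Qed.

Lemma differentiable_pt_lim_proj2 (f : R -> R) (x y l : R) :
  derivable_pt_lim f y l ->
  differentiable_pt_lim (fun _ v => f v) x y 0 l.
Proof.
intros H eps.
destruct (differentiable_pt_lim_proj1_0 f y x l H eps) as [d Hd].
exists d; intros u v Hu Hv.
replace (0 * (u - x) + l * (v - y)) with (l * (v - y) + 0 * (u - x)) by ring.
rewrite Rmax_comm; now apply Hd.
Qed.

Lemma differentiable_pt_lim_exp_mult (k : R) (g : R -> R) (s t l : R) :
  derivable_pt_lim g t l ->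
  differentiable_pt_lim (fun s t => k + exp s * g t) s t
    (exp s * g t) (exp s * l).
Proof.
intros Hg.
assert (Hm : forall x y, differentiable_pt_lim (fun u v => k + u * v) x y y x).
{ intros x y eps; exists eps; intros u v Hu Hv.
  replace (k + u * v - (k + x * y) - (y * (u - x) + x * (v - y)))
    with ((u - x) * (v - y)) by ring.
  rewrite Rabs_mult.
  pose proof (Rmax_r (Rabs (u - x)) (Rabs (v - y))).
  pose proof (Rabs_pos (u - x)); pose proof (Rabs_pos (v - y)); nra. }
pose proof (differentiable_pt_lim_comp (fun u v => k + u * v)
  (fun s _ => exp s) (fun _ t => g t) s t _ _ _ _ _ _
  (Hm (exp s) (g t))
  (differentiable_pt_lim_proj1_0 exp s t _ (derivable_pt_lim_exp s))
  (differentiable_pt_lim_proj2 g s t _ Hg)) as H.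
replace (exp s * g t) with (g t * exp s + exp s * 0) by ring.
replace (exp s * l) with (g t * 0 + exp s * l) by ring.
exact H.
Qed.

(** In polar coordinates, Re f dt + Im f ds is closed where f is complex
    differentiable. *)
Lemma polar_form_closed (f : C -> C) (c : C) (s t : R) :
  ex_derive (K := C_AbsRing) (V := C_NormedModule) f (polar c s t) ->
  exists px e qy,
    differentiable_pt_lim (fun s t => Im (f (polar c s t))) s t px e /\
    differentiable_pt_lim (fun s t => Re (f (polar c s t))) s t e qy.
Proof.
intros [l Hl].
destruct (is_derive_C_Re_Im f _ _ l Hl) as [HR HI].
pose proof (differentiable_pt_lim_exp_mult (Re c) cos s t _ (derivable_pt_lim_cos t)) as HX.
pose proof (differentiable_pt_lim_exp_mult (Im c) sin s t _ (derivable_pt_lim_sin t)) as HY.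
pose proof (differentiable_pt_lim_comp _ _ _ s t _ _ _ _ _ _ HR HX HY) as KR.
pose proof (differentiable_pt_lim_comp _ _ _ s t _ _ _ _ _ _ HI HX HY) as KI.
simpl in KR, KI.
eexists; eexists; eexists; split; [exact KI|].
replace (Im l * (exp s * - sin t) + Re l * (exp s * cos t))
  with (Re l * (exp s * cos t) + - Im l * (exp s * sin t)) by ring.
exact KR.
Qed.

(** The mean value property; differentiability at the centre is replaced by
    continuity. *)
Theorem mean_value (f : C -> C) (c : C) (rho s : R) :
  (forall w, 0 < Cmod (w - c) < rho ->
     ex_derive (K := C_AbsRing) (V := C_NormedModule) f w) ->
  C_continuous f c -> exp s < rho ->
  ex_RInt (fun t => Re (f (polar c s t))) 0 (2 * PI) /\
  RInt (fun t => Re (f (polar c s t))) 0 (2 * PI) = 2 * PI * Re (f c).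
Proof.
intros Hf Hc Hs.
assert (HPI := PI_RGT_0).
assert (Hclosed : forall s' t, s' <= s -> exists px e qy,
  differentiable_pt_lim (fun s t => Im (f (polar c s t))) s' t px e /\
  differentiable_pt_lim (fun s t => Re (f (polar c s t))) s' t e qy).
{ intros s' t Hs'; apply polar_form_closed, Hf.
  rewrite Cmod_polar; split; [apply exp_pos|].
  assert (exp s' <= exp s) by (destruct Hs' as [Hs'| ->]; [left; now apply exp_increasing|lra]).
  lra. }
assert (Hex : forall s', s' <= s -> ex_RInt (fun t => Re (f (polar c s' t))) 0 (2 * PI)).
{ intros s' Hs'; apply (ex_RInt_continuous (V := R_CompleteNormedModule)).
  intros t _; destruct (Hclosed s' t Hs') as (px & e & qy & _ & H).
  now apply differentiable_pt_lim_section_r in H. }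
split; [apply Hex; lra|].
(* The integral over the circle of radius exp s' does not depend on s'. *)
assert (Hconst : forall s', s' <= s ->
  RInt (fun t => Re (f (polar c s t))) 0 (2 * PI) =
  RInt (fun t => Re (f (polar c s' t))) 0 (2 * PI)).
{ intros s' Hs'.
  pose proof (goursat (fun s t => Im (f (polar c s t)))
    (fun s t => Re (f (polar c s t))) s' s 0 (2 * PI) Hs' ltac:(lra)) as H.
  unfold boundary_integral in H.
  replace (RInt (fun x => Im (f (polar c x (2 * PI)))) s' s)
    with (RInt (fun x => Im (f (polar c x 0))) s' s) in H.
  - enough (forall a b d : R, a + b - a - d = 0 -> b = d) as E
      by (eapply E, H; intros; apply Hclosed; lra).
    intros; lra.
  - apply RInt_ext; intros x _; unfold polar.
    now rewrite cos_2PI, sin_2PI, cos_0, sin_0. }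
apply cond_eq; intros eps Heps.
destruct (Hc (eps / (4 * PI))) as (d & Hd & HH); [apply Rdiv_lt_0_compat; lra|].
set (s' := Rmin s (ln (d / 2))).
assert (Hs' : exp s' < d).
{ apply Rle_lt_trans with (d / 2); [|lra].
  rewrite <- (exp_ln (d / 2)) by lra.
  destruct (Rmin_r s (ln (d / 2))) as [K|K].
  - left; now apply exp_increasing.
  - unfold s'; rewrite K; lra. }
rewrite (Hconst s') by apply Rmin_l.
replace (2 * PI * Re (f c)) with ((2 * PI - 0) * Re (f c)) by ring.
apply Rle_lt_trans with ((2 * PI - 0) * (eps / (4 * PI))).
- apply RInt_near_const; [lra|apply Hex, Rmin_l|].
  intros t _; left; eapply Rle_lt_trans; [|apply (HH (polar c s' t)); now rewrite Cmod_polar].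
  eapply Rle_trans; [|apply re_le_Cmod].
  apply Req_le; reflexivity.
- replace ((2 * PI - 0) * (eps / (4 * PI))) with (eps / 2) by (field; lra); lra.
Qed.

(** * The maximum principle *)

Lemma Cmod_sq (z : C) : Cmod z ^ 2 = Re z * Re z + Im z * Im z.
Proof. rewrite Cmod2_alt; ring. Qed.

(** A continuous real function on a closed disc attains its maximum. *)
Lemma disc_extreme_value (u : C -> R) (r : R) :
  0 <= r ->
  (forall z, Cmod z <= r -> forall eps, 0 < eps -> exists delta, 0 < delta /\
     forall w, Cmod (w - z) < delta -> Rabs (u w - u z) < eps) ->
  exists z, Cmod z <= r /\ forall w, Cmod w <= r -> u w <= u z.
Proof.
intros Hr Hu.
apply NNPP; intros Hno.
assert (Hbig : forall z, Cmod z <= r -> exists z', Cmod z' <= r /\ u z < u z').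
{ intros z Hz; apply NNPP; intros Hn; apply Hno; exists z; split; trivial.
  intros w Hw; apply Rnot_lt_le; intros Hlt; apply Hn; now exists w. }
assert (H2 : 0 < sqrt 2) by (apply sqrt_lt_R0; lra).
(* Were the maximum not attained, every rectangle would contain only values
   below u z' for a single z' in the disc. *)
assert (HP : exists z', Cmod z' <= r /\ forall x y, -r <= x <= r -> -r <= y <= r ->
          Cmod (x, y) <= r -> u (x, y) < u z').
{ apply (rectangle_bisection (fun a b c d => exists z', Cmod z' <= r /\
    forall x y, a <= x <= b -> c <= y <= d -> Cmod (x, y) <= r -> u (x, y) < u z'));
    [lra|lra| |].
  - intros a b c d H3 H4 H5 H6 H7 H8 m n
      (z1 & K1 & L1) (z2 & K2 & L2) (z3 & K3 & L3) (z4 & K4 & L4).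
    assert (Hmax : exists z', Cmod z' <= r /\
      u z1 <= u z' /\ u z2 <= u z' /\ u z3 <= u z' /\ u z4 <= u z').
    { assert (Htwo : forall p q, Cmod p <= r -> Cmod q <= r ->
        exists z', Cmod z' <= r /\ u p <= u z' /\ u q <= u z').
      { intros p q Hp Hq; destruct (Rle_lt_dec (u p) (u q)).
        - exists q; lra.
        - exists p; lra. }
      destruct (Htwo z1 z2 K1 K2) as (p & Hp & ? & ?).
      destruct (Htwo z3 z4 K3 K4) as (q & Hq & ? & ?).
      destruct (Htwo p q Hp Hq) as (z' & Hz' & ? & ?).
      exists z'; lra. }
    destruct Hmax as (z' & Hz' & M1 & M2 & M3 & M4).
    exists z'; split; trivial; intros x y Hx Hy Hxy.
    destruct (Rle_lt_dec x m); destruct (Rle_lt_dec y n).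
    + apply Rlt_le_trans with (u z1); trivial; apply L1; trivial; lra.
    + apply Rlt_le_trans with (u z3); trivial; apply L3; trivial; lra.
    + apply Rlt_le_trans with (u z2); trivial; apply L2; trivial; lra.
    + apply Rlt_le_trans with (u z4); trivial; apply L4; trivial; lra.
  - intros p q Hp Hq.
    (* A point outside the disc has a neighbourhood disjoint from it, where
       the condition is vacuous and any z' will do. *)
    assert (Hloc : exists z' delta, Cmod z' <= r /\ 0 < delta /\ forall w,
      Cmod (w - (p, q)) < delta -> Cmod w <= r -> u w < u z').
    { destruct (Rle_lt_dec (Cmod (p, q)) r) as [Hin|Hout].
      - destruct (Hbig _ Hin) as (z' & Hz' & Hlt).
        destruct (Hu _ Hin (u z' - u (p, q))) as (d & Hd & HH); [lra|].
        exists z', d; repeat split; trivial; intros w Hw _.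
        specialize (HH w Hw); apply Rabs_lt_between in HH; lra.
      - exists 0%C, (Cmod (p, q) - r); rewrite Cmod_0; repeat split; try lra.
        intros w Hw Hwr; set (v := (p, q) : C) in *.
        pose proof (Cmod_triangle w (- (w - v))) as T.
        replace (w + - (w - v))%C with v in T by ring.
        rewrite Cmod_opp in T; lra. }
    destruct Hloc as (z' & d & Hz' & Hd & HH).
    exists (d / sqrt 2); split; [now apply Rdiv_lt_0_compat|].
    intros a b c e A1 A2 A3 B1 B2 B3 HA HB.
    exists z'; split; trivial; intros x y Hx Hy Hxy; apply HH; trivial.
    eapply Rle_lt_trans; [apply Cmod_2Rmax|]; simpl.
    replace d with (sqrt 2 * (d / sqrt 2)) by (field; lra).
    apply Rmult_lt_compat_l; trivial.
    apply Rmax_lub_lt; apply Rabs_lt_between; lra. }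
destruct HP as (z' & Hz' & HH).
pose proof (Rmax_Cmod z') as HM.
pose proof (Rmax_l (Rabs (fst z')) (Rabs (snd z'))) as M1.
pose proof (Rmax_r (Rabs (fst z')) (Rabs (snd z'))) as M2.
assert (N1 : Rabs (fst z') <= r) by lra; assert (N2 : Rabs (snd z') <= r) by lra.
apply Rabs_le_between in N1; apply Rabs_le_between in N2.
destruct z' as [x y]; simpl in *.
specialize (HH x y N1 N2 Hz'); lra.
Qed.

(** Re f cannot drop quadratically in every direction from a point: its mean
    over a small circle would be smaller than its value at the centre. *)
Lemma no_quadratic_peak (f : C -> C) (c : C) (rho eps : R) :
  0 < rho -> 0 < eps ->
  (forall w, 0 < Cmod (w - c) < rho ->
     ex_derive (K := C_AbsRing) (V := C_NormedModule) f w) ->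
  C_continuous f c ->
  ~ (forall w, Cmod (w - c) < rho ->
       Re (f w) <= Re (f c) - eps * Cmod (w - c) ^ 2).
Proof.
intros Hrho Heps Hf Hc Hpeak.
set (s := ln (rho / 2)).
assert (Es : exp s = rho / 2) by (apply exp_ln; lra).
destruct (mean_value f c rho s Hf Hc) as [Hex Hmean]; [lra|].
assert (HPI := PI_RGT_0).
assert (Hle : RInt (fun t => Re (f (polar c s t))) 0 (2 * PI) <=
  RInt (fun _ => Re (f c) - eps * (rho / 2) ^ 2) 0 (2 * PI)).
{ apply RInt_le; trivial; [lra|apply ex_RInt_const|].
  intros t _.
  pose proof (Hpeak (polar c s t)) as H.
  rewrite Cmod_polar, Es in H; apply H; lra. }
rewrite Hmean, RInt_const in Hle.
unfold scal in Hle; simpl in Hle; unfold mult in Hle; simpl in Hle.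
assert (0 < eps * (rho / 2 * (rho / 2 * 1))) by (repeat apply Rmult_lt_0_compat; lra).
nra.
Qed.

(** The maximum principle for the real part on a closed disc; differentiability
    at the centre is replaced by continuity. *)
Theorem maximum_principle (f : C -> C) (r M : R) :
  (forall w, Cmod w <= r -> C_continuous f w) ->
  (forall w, 0 < Cmod w < r ->
     ex_derive (K := C_AbsRing) (V := C_NormedModule) f w) ->
  (forall w, Cmod w = r -> Re (f w) <= M) ->
  forall z, Cmod z <= r -> Re (f z) <= M.
Proof.
intros Hcont Hdiff Hbd z0 Hz0; apply Rnot_lt_le; intros Hlt.
assert (Hr : 0 <= r) by (pose proof (Cmod_ge_0 z0); lra).
(* Adding eps |w|^2 makes an interior maximum point a quadratic peak of a
   function with the same differentiability as f. *)
set (eps := (Re (f z0) - M) / (2 * (r ^ 2 + 1))).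
assert (Hden : 0 < 2 * (r ^ 2 + 1)) by nra.
assert (Heps : 0 < eps) by (apply Rdiv_lt_0_compat; lra).
assert (Eeps : eps * (2 * (r ^ 2 + 1)) = Re (f z0) - M)
  by (unfold eps; field; lra).
destruct (disc_extreme_value (fun w => Re (f w) + eps * Cmod w ^ 2) r Hr)
  as (c & Hc & Hmax).
{ intros z Hz e He.
  destruct (Hcont z Hz (e / 2)) as (d & Hd & HH); [lra|].
  set (A := eps * (2 * r + 1)).
  assert (HA : 0 < A) by (unfold A; nra).
  set (d' := e / 2 / A).
  assert (Hd' : 0 < d') by (apply Rdiv_lt_0_compat; lra).
  assert (Ed' : d' * A = e / 2) by (unfold d'; field; lra).
  exists (Rmin d (Rmin 1 d')); split.
  { repeat apply Rmin_glb_lt; lra. }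
  intros w Hw.
  pose proof (Rmin_l d (Rmin 1 d')); pose proof (Rmin_r d (Rmin 1 d')).
  pose proof (Rmin_l 1 d'); pose proof (Rmin_r 1 d').
  assert (K1 : Rabs (Re (f w) - Re (f z)) < e / 2).
  { eapply Rle_lt_trans; [|apply (HH w); lra].
    eapply Rle_trans; [|apply re_le_Cmod].
    apply Req_le; reflexivity. }
  assert (T1 : Cmod w <= Cmod z + Cmod (w - z)).
  { replace w with (z + (w - z))%C at 1 by ring; apply Cmod_triangle. }
  assert (T2 : Cmod z <= Cmod w + Cmod (w - z)).
  { replace z with (w + - (w - z))%C at 1 by ring.
    rewrite <- (Cmod_opp (w - z)); apply Cmod_triangle. }
  pose proof (Cmod_ge_0 w); pose proof (Cmod_ge_0 z); pose proof (Cmod_ge_0 (w - z)).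
  assert (K2 : Rabs (eps * Cmod w ^ 2 - eps * Cmod z ^ 2) <= Cmod (w - z) * A).
  { replace (eps * Cmod w ^ 2 - eps * Cmod z ^ 2)
      with ((Cmod w - Cmod z) * (eps * (Cmod w + Cmod z))) by ring.
    rewrite Rabs_mult.
    apply Rmult_le_compat; try apply Rabs_pos; [apply Rabs_le; lra|].
    rewrite Rabs_pos_eq by nra.
    apply Rmult_le_compat_l; lra. }
  apply Rabs_lt_between in K1; apply Rabs_le_between in K2.
  apply Rabs_lt_between; nra. }
assert (Hint : Cmod c < r).
{ destruct Hc as [Hc|Hc]; trivial; exfalso.
  pose proof (Hbd c Hc); pose proof (Hmax z0 Hz0) as H1; simpl in H1.
  rewrite Hc in H1; pose proof (Cmod_ge_0 z0).
  assert (0 <= eps * (Cmod z0 * (Cmod z0 * 1))) by (apply Rmult_le_pos; nra).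
  nra. }
set (g := fun w => (f w + RtoC (2 * eps) * Cconj c * (w - c))%C).
assert (Hlin : forall w, ex_derive (K := C_AbsRing) (V := C_NormedModule)
  (fun w => RtoC (2 * eps) * Cconj c * (w - c))%C w).
{ intros w; set (k := (RtoC (2 * eps) * Cconj c)%C).
  apply (ex_derive_ext (K := C_AbsRing) (V := C_NormedModule)
           (fun w => - k * c + k * w)%C); [|apply ex_derive_Caffine].
  intros v; change (- k * c + k * v = k * (v - c))%C; ring. }
(* The punctured disc of radius rho around c avoids the origin. *)
set (rho := if Req_EM_T (Cmod c) 0 then r else Rmin (r - Cmod c) (Cmod c)).
assert (Hrho : 0 < rho /\ rho <= r - Cmod c /\
               forall w, 0 < Cmod (w - c) < rho -> 0 < Cmod w).
{ pose proof (Cmod_ge_0 c).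
  unfold rho; destruct (Req_EM_T (Cmod c) 0) as [E|E].
  - repeat split; try lra; intros w Hw.
    apply Cmod_eq_0 in E; subst c.
    replace (w - 0)%C with w in Hw by ring; lra.
  - repeat split; [apply Rmin_glb_lt; lra|apply Rmin_l|].
    intros w Hw.
    pose proof (Rmin_r (r - Cmod c) (Cmod c)).
    pose proof (Cmod_triangle w (- (w - c))) as T.
    replace (w + - (w - c))%C with c in T by ring.
    rewrite Cmod_opp in T; lra. }
destruct Hrho as (Hrho & Hrho1 & Hrho2).
assert (Hnear : forall w, Cmod (w - c) < rho -> Cmod w < r).
{ intros w Hw; pose proof (Cmod_triangle c (w - c)) as T.
  replace (c + (w - c))%C with w in T by ring; lra. }
apply (no_quadratic_peak g c rho eps Hrho Heps).
- intros w Hw; apply (ex_derive_plus (V := C_NormedModule)); [|apply Hlin].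
  apply Hdiff; split; [now apply Hrho2|apply Hnear; lra].
- intros e He.
  destruct (Hcont c Hc (e / 2)) as (d1 & Hd1 & H1); [lra|].
  destruct (ex_derive_C_continuous _ c (Hlin c) (e / 2)) as (d2 & Hd2 & H2); [lra|].
  exists (Rmin d1 d2); split; [now apply Rmin_glb_lt|].
  intros w Hw; pose proof (Rmin_l d1 d2); pose proof (Rmin_r d1 d2).
  specialize (H1 w ltac:(lra)); specialize (H2 w ltac:(lra)).
  unfold g; match goal with |- Cmod ?x < _ => replace x with
    ((f w - f c) + (RtoC (2 * eps) * Cconj c * (w - c)
                    - RtoC (2 * eps) * Cconj c * (c - c)))%C by ring end.
  eapply Rle_lt_trans; [apply Cmod_triangle|]; lra.
- intros w Hw.
  pose proof (Hmax w (Rlt_le _ _ (Hnear w Hw))) as H; cbv beta in H.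
  rewrite (Cmod_sq w), (Cmod_sq c) in H; rewrite Cmod_sq; unfold g.
  destruct (f w), (f c), w, c; simpl in H |- *; lra.
Qed.

(** * The Schwarz-Pick inequality *)

Lemma schwarz (h : C -> C) :
  holomorphic_self_map h -> h 0 = 0%C ->
  forall z, unit_disc z -> Cmod (h z) <= Cmod z.
Proof.
intros Hh H0 z Hz.
destruct (Req_dec (Cmod z) 0) as [Ez|Ez].
{ apply Cmod_eq_0 in Ez; subst z; rewrite H0, Cmod_0; lra. }
assert (D0 : unit_disc 0) by (unfold unit_disc; rewrite Cmod_0; lra).
destruct (proj2 (Hh 0%C D0)) as [l Hl].
(* The quotient h w / w, extended by h' 0 at the origin. *)
set (q := fun w : C => if excluded_middle_informative (w = 0%C) then l : C else (h w / w)%C).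
assert (Eq : forall w : C, w <> 0%C -> q w = (h w / w)%C).
{ intros w Hw; unfold q; destruct (excluded_middle_informative (w = 0%C)); tauto. }
assert (Eq0 : q 0%C = l).
{ unfold q; destruct (excluded_middle_informative _); tauto. }
assert (Hqd : forall w, 0 < Cmod w < 1 ->
  ex_derive (K := C_AbsRing) (V := C_NormedModule) q w).
{ intros w Hw.
  assert (Hw0 : w <> 0%C) by (apply Cmod_gt_0; lra).
  apply (ex_derive_ext_loc (K := C_AbsRing) (V := C_NormedModule) (fun w => h w * / w)%C).
  - exists (mkposreal _ (proj1 Hw)); intros v Hv.
    symmetry; apply Eq; intros ->.
    change (Cmod (0 - w) < Cmod w) in Hv.
    replace (0 - w)%C with (- w)%C in Hv by ring.
    rewrite Cmod_opp in Hv; lra.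
  - apply ex_derive_Cmult; [apply Hh; exact (proj2 Hw)|].
    eexists; now apply is_derive_Cinv. }
assert (Hqc : forall w, Cmod w < 1 -> C_continuous q w).
{ intros w Hw.
  destruct (Req_dec (Cmod w) 0) as [Ew|Ew].
  - apply Cmod_eq_0 in Ew; subst w.
    rewrite is_derive_C_iff in Hl; intros e He.
    destruct (Hl (e / 2)) as (d & Hd & HH); [lra|].
    exists d; split; trivial; intros w Hwd.
    rewrite Eq0; destruct (Req_dec (Cmod w) 0) as [Ew|Ew].
    + apply Cmod_eq_0 in Ew; subst w; rewrite Eq0.
      replace (l - l)%C with (RtoC 0) by ring; rewrite Cmod_0; lra.
    + assert (Hw0 : 0 < Cmod w) by (pose proof (Cmod_ge_0 w); lra).
      assert (Hw1 : w <> 0%C) by now apply Cmod_gt_0.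
      specialize (HH w Hwd); rewrite H0 in HH.
      replace (h w - 0 - l * (w - 0))%C with ((q w - l) * w)%C in HH
        by (rewrite Eq by trivial; field; trivial).
      replace (w - 0)%C with w in HH by ring.
      rewrite Cmod_mult in HH.
      apply Rmult_le_reg_r in HH; lra.
  - apply ex_derive_C_continuous, Hqd; pose proof (Cmod_ge_0 w); lra. }
assert (Hz0 : 0 < Cmod z) by (pose proof (Cmod_ge_0 z); lra).
assert (Hz1 : z <> 0%C) by now apply Cmod_gt_0.
unfold unit_disc in Hz.
assert (Hqz : forall r, Cmod z <= r < 1 -> r * Cmod (q z) <= 1).
{ intros r Hr.
  destruct (Req_dec (Cmod (q z)) 0) as [Eqz|Eqz]; [rewrite Eqz; lra|].
  assert (Hqz : 0 < Cmod (q z)) by (pose proof (Cmod_ge_0 (q z)); lra).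
  (* Multiplication by the conjugate of q z turns |q z|^2 into a real part. *)
  assert (HM : Re (Cconj (q z) * q z)%C <= Cmod (q z) / r).
  { apply (maximum_principle (fun w => Cconj (q z) * q w)%C r); [| | |lra].
    - intros w Hw e He.
      destruct (Hqc w ltac:(lra) (e / Cmod (q z))) as (d & Hd & HH);
        [now apply Rdiv_lt_0_compat|].
      exists d; split; trivial; intros v Hv; specialize (HH v Hv).
      replace (Cconj (q z) * q v - Cconj (q z) * q w)%C
        with (Cconj (q z) * (q v - q w))%C by ring.
      rewrite Cmod_mult, Cmod_conj.
      apply (Rmult_lt_compat_l _ _ _ Hqz) in HH.
      replace (Cmod (q z) * (e / Cmod (q z))) with e in HH by (field; lra).
      exact HH.
    - intros w Hw.
      apply ex_derive_Cmult; [|apply Hqd; lra].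
      apply (ex_derive_const (V := C_NormedModule)).
    - intros w Hw.
      eapply Rle_trans; [apply Rle_abs|].
      eapply Rle_trans; [apply re_le_Cmod|].
      assert (w <> 0%C) by (apply Cmod_gt_0; lra).
      rewrite Cmod_mult, Cmod_conj, (Eq w), Cmod_div, Hw by trivial.
      unfold Rdiv; apply Rmult_le_compat_l; [lra|].
      rewrite <- (Rmult_1_l (/ r)) at 2.
      apply Rmult_le_compat_r; [left; apply Rinv_0_lt_compat; lra|].
      left; apply Hh; unfold unit_disc; lra. }
  replace (Re (Cconj (q z) * q z)%C) with (Cmod (q z) * Cmod (q z)) in HM
    by (rewrite <- (Rmult_1_r (Cmod (q z))) at 2; rewrite <- Rmult_1_r;
        transitivity (Cmod (q z) ^ 2); [ring|rewrite Cmod_sq; destruct (q z); simpl; ring]).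
  apply (Rmult_le_reg_l (Cmod (q z))); trivial.
  apply (Rmult_le_compat_r r) in HM; [|lra].
  replace (Cmod (q z) / r * r) with (Cmod (q z)) in HM by (field; lra).
  nra. }
assert (Hq1 : Cmod (q z) <= 1).
{ apply Rnot_lt_le; intros Hgt.
  assert (Hinv : / Cmod (q z) < 1).
  { rewrite <- Rinv_1; apply Rinv_lt_contravar; lra. }
  set (r := Rmax (Cmod z) ((1 + / Cmod (q z)) / 2)).
  assert (Hr : Cmod z <= r < 1).
  { split; [apply Rmax_l|apply Rmax_lub_lt; lra]. }
  specialize (Hqz r Hr).
  assert (Hr2 : (1 + / Cmod (q z)) / 2 <= r) by apply Rmax_r.
  assert (E : / Cmod (q z) * Cmod (q z) = 1) by (field; lra).
  nra. }
rewrite (Eq z Hz1), Cmod_div in Hq1 by trivial.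
apply (Rmult_le_compat_r (Cmod z)) in Hq1; [|lra].
replace (Cmod (h z) / Cmod z * Cmod z) with (Cmod (h z)) in Hq1 by (field; lra).
lra.
Qed.

(** The identity behind all estimates on [mobius]. *)
Lemma Cmod_one_minus_conj_sq (z w : C) :
  Cmod (1 - Cconj z * w) ^ 2 - Cmod (z - w) ^ 2
  = (1 - Cmod z ^ 2) * (1 - Cmod w ^ 2).
Proof. rewrite !Cmod_sq; destruct z, w; simpl; ring. Qed.

Lemma Cmod_one_minus_conj_ge (z w : C) :
  1 - Cmod z * Cmod w <= Cmod (1 - Cconj z * w).
Proof.
pose proof (Cmod_triangle (1 - Cconj z * w) (Cconj z * w)) as T.
replace (1 - Cconj z * w + Cconj z * w)%C with (RtoC 1) in T by ring.
rewrite Cmod_1, Cmod_mult, Cmod_conj in T; lra.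
Qed.

Lemma Cmod_one_minus_conj_gt0 (z w : C) :
  unit_disc z -> unit_disc w -> 0 < Cmod (1 - Cconj z * w).
Proof.
unfold unit_disc; intros Hz Hw.
pose proof (Cmod_one_minus_conj_ge z w).
pose proof (Cmod_ge_0 z); pose proof (Cmod_ge_0 w); nra.
Qed.

Lemma Cmod_mobius (z w : C) :
  unit_disc z -> unit_disc w ->
  Cmod (mobius z w) = Cmod (z - w) / Cmod (1 - Cconj z * w).
Proof.
intros Hz Hw; apply Cmod_div, Cmod_gt_0.
now apply Cmod_one_minus_conj_gt0.
Qed.

Lemma Cmod_mobius_le_iff (z w : C) (k : R) :
  unit_disc z -> unit_disc w ->
  (Cmod (mobius z w) <= k <-> Cmod (z - w) <= k * Cmod (1 - Cconj z * w)).
Proof.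
intros Hz Hw; pose proof (Cmod_one_minus_conj_gt0 z w Hz Hw) as HN.
rewrite Cmod_mobius by trivial.
set (N := Cmod (1 - Cconj z * w)) in *; set (d := Cmod (z - w)).
assert (E : d / N * N = d) by (field; lra).
split; intros H.
- apply (Rmult_le_compat_r N) in H; lra.
- apply (Rmult_le_reg_r N); lra.
Qed.

Lemma one_minus_Cmod_mobius_sq (z w : C) :
  unit_disc z -> unit_disc w ->
  1 - Cmod (mobius z w) ^ 2
  = (1 - Cmod z ^ 2) * (1 - Cmod w ^ 2) / Cmod (1 - Cconj z * w) ^ 2.
Proof.
intros Hz Hw; pose proof (Cmod_one_minus_conj_gt0 z w Hz Hw) as HN.
rewrite <- Cmod_one_minus_conj_sq, Cmod_mobius by trivial.
field; lra.
Qed.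

Lemma Cmod_mobius_lt_1 (z w : C) :
  unit_disc z -> unit_disc w -> Cmod (mobius z w) < 1.
Proof.
intros Hz Hw; pose proof (Cmod_one_minus_conj_gt0 z w Hz Hw) as HN.
pose proof (one_minus_Cmod_mobius_sq z w Hz Hw) as E.
assert (0 < (1 - Cmod z ^ 2) * (1 - Cmod w ^ 2) / Cmod (1 - Cconj z * w) ^ 2).
{ unfold unit_disc in *.
  pose proof (Cmod_ge_0 z); pose proof (Cmod_ge_0 w).
  apply Rdiv_lt_0_compat; [apply Rmult_lt_0_compat; nra|now apply pow_lt]. }
pose proof (Cmod_ge_0 (mobius z w)); nra.
Qed.

(** The Schwarz-Pick inequality with base point 0: the Schwarz lemma for
    [mobius (f 0)] composed with [f]. *)
Theorem schwarz_pick (f : C -> C) :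
  holomorphic_self_map f ->
  forall z, unit_disc z -> Cmod (mobius (f 0) (f z)) <= Cmod z.
Proof.
intros Hf.
assert (D0 : unit_disc 0) by (unfold unit_disc; rewrite Cmod_0; lra).
assert (Df0 : unit_disc (f 0)) by now apply Hf.
apply (schwarz (fun z => mobius (f 0) (f z))).
- intros z Hz; destruct (Hf z Hz) as [Dfz Hd]; split.
  + now apply Cmod_mobius_lt_1.
  + apply (ex_derive_Ccomp (mobius (f 0)) f); trivial.
    apply (ex_derive_ext (K := C_AbsRing) (V := C_NormedModule)
      (fun w => (f 0 + - (1) * w) * / (1 + - Cconj (f 0) * w))%C).
    { intros w; unfold mobius, Cdiv.
      now replace (f 0%R - w)%C with (f 0%R + - (1) * w)%C by ring;
        replace (1 - Cconj (f 0%R) * w)%C with (1 + - Cconj (f 0%R) * w)%C by ring. }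
    apply ex_derive_Cmult; [apply ex_derive_Caffine|].
    apply (ex_derive_Ccomp Cinv); [|apply ex_derive_Caffine].
    eexists; apply is_derive_Cinv, Cmod_gt_0.
    replace (1 + - Cconj (f 0%R) * f z)%C with (1 - Cconj (f 0%R) * f z)%C by ring.
    now apply Cmod_one_minus_conj_gt0.
- unfold mobius, Cdiv.
  replace (f 0%R - f 0%R)%C with (RtoC 0) by ring; ring.
Qed.

(** * Hyperbolic geometry of the disc *)

Lemma Cmod_minus_sym (z w : C) : Cmod (z - w) = Cmod (w - z).
Proof. rewrite <- Cmod_opp; f_equal; ring. Qed.

Lemma Cmod_mobius_sym (z w : C) :
  unit_disc z -> unit_disc w -> Cmod (mobius z w) = Cmod (mobius w z).
Proof.
intros Hz Hw; rewrite !Cmod_mobius by trivial; f_equal.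
- apply Cmod_minus_sym.
- rewrite <- Cmod_conj; f_equal.
  destruct z, w; apply injective_projections; simpl; ring.
Qed.

(** Points at bounded pseudo-hyperbolic distance have comparable distances to
    the boundary, which also bound their Euclidean distance. *)
Lemma mobius_bounded_comparison (k : R) (z w : C) :
  k < 1 -> unit_disc z -> unit_disc w -> Cmod (mobius z w) <= k ->
  1 - Cmod z <= 2 / (1 - k) * (1 - Cmod w) /\
  Cmod (z - w) <= 2 / (1 - k) * (1 - Cmod z).
Proof.
intros Hk Hz Hw H.
assert (Hk0 : 0 <= k) by (pose proof (Cmod_ge_0 (mobius z w)); lra).
assert (HN : forall u v, unit_disc u -> unit_disc v -> Cmod (mobius u v) <= k ->
          Cmod (1 - Cconj u * v) <= 2 / (1 - k) * (1 - Cmod u)).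
{ intros u v Hu Hv Huv; apply Cmod_mobius_le_iff in Huv; trivial.
  pose proof (Cmod_triangle (1 - Cconj u * u) (Cconj u * (u - v))) as T.
  replace (1 - Cconj u * u + Cconj u * (u - v))%C with (1 - Cconj u * v)%C in T by ring.
  assert (E : Cmod (1 - Cconj u * u) = 1 - Cmod u ^ 2).
  { replace (1 - Cconj u * u)%C with (RtoC (1 - Cmod u ^ 2)).
    - rewrite Cmod_R; apply Rabs_pos_eq; unfold unit_disc in Hu.
      pose proof (Cmod_ge_0 u); nra.
    - rewrite Cmod_sq; destruct u; apply injective_projections; simpl; ring. }
  rewrite E, Cmod_mult, Cmod_conj in T.
  set (N := Cmod (1 - Cconj u * v)) in *.
  unfold unit_disc in Hu.
  pose proof (Cmod_ge_0 u); pose proof (Cmod_ge_0 (u - v)).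
  apply (Rmult_le_reg_l (1 - k)); [lra|].
  replace ((1 - k) * (2 / (1 - k) * (1 - Cmod u))) with (2 * (1 - Cmod u))
    by (field; lra).
  assert (Cmod u * Cmod (u - v) <= k * N) by nra.
  nra. }
pose proof (HN z w Hz Hw H) as N1.
pose proof (HN w z Hw Hz) as N2; rewrite <- Cmod_mobius_sym in N2 by trivial.
specialize (N2 H).
pose proof (Cmod_one_minus_conj_ge w z) as G.
apply Cmod_mobius_le_iff in H; trivial.
unfold unit_disc in *.
pose proof (Cmod_ge_0 z); pose proof (Cmod_ge_0 w).
pose proof (Cmod_ge_0 (1 - Cconj z * w)).
split; nra.
Qed.

(** A Stolz region is carried into another one by a bounded pseudo-hyperbolic
    perturbation. *)
Lemma nontangential_transfer (tau z w : C) (k M : R) :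
  k < 1 -> unit_disc z -> unit_disc w -> Cmod (mobius z w) <= k ->
  Cmod (tau - z) <= M * (1 - Cmod z) ->
  Cmod (tau - w) <= (M + 2 / (1 - k)) * (2 / (1 - k)) * (1 - Cmod w).
Proof.
intros Hk Hz Hw H HM.
destruct (mobius_bounded_comparison k z w Hk Hz Hw H) as [H1 H2].
set (K := 2 / (1 - k)) in *.
assert (HK : 0 < K) by (apply Rdiv_lt_0_compat; lra).
pose proof (Cmod_triangle (tau - z) (z - w)) as T.
replace (tau - z + (z - w))%C with (tau - w)%C in T by ring.
pose proof (Cmod_ge_0 (tau - z)); unfold unit_disc in *.
assert (0 <= M) by nra.
assert ((M + K) * (1 - Cmod z) <= (M + K) * (K * (1 - Cmod w)))
  by (apply Rmult_le_compat_l; lra).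
lra.
Qed.

(** [hyp_dist z w] is [artanh] of the pseudo-hyperbolic distance. *)
Definition artanh (x : R) : R := / 2 * ln ((1 + x) / (1 - x)).

Lemma artanh_increasing (x y : R) : -1 < x -> x < y -> y < 1 -> artanh x < artanh y.
Proof.
intros Hx Hxy Hy; unfold artanh.
apply Rmult_lt_compat_l; [lra|].
apply ln_increasing; [apply Rdiv_lt_0_compat; lra|].
apply (Rmult_lt_reg_r ((1 - x) * (1 - y))); [nra|].
replace ((1 + x) / (1 - x) * ((1 - x) * (1 - y))) with ((1 + x) * (1 - y)) by (field; lra).
replace ((1 + y) / (1 - y) * ((1 - x) * (1 - y))) with ((1 + y) * (1 - x)) by (field; lra).
nra.
Qed.

Lemma hyp_dist_le_artanh (z w : C) (k : R) :
  k < 1 -> Cmod (mobius z w) <= k -> hyp_dist z w <= artanh k.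
Proof.
intros Hk [H| <-]; [left|right; reflexivity].
apply (artanh_increasing (Cmod (mobius z w))); trivial.
pose proof (Cmod_ge_0 (mobius z w)); lra.
Qed.

(** A bound B on the hyperbolic distance gives the bound tanh |B| on the
    pseudo-hyperbolic one. *)
Lemma hyp_dist_bounded_mobius (B : R) :
  exists k, k < 1 /\ forall z w, unit_disc z -> unit_disc w ->
    hyp_dist z w <= B -> Cmod (mobius z w) <= k.
Proof.
set (E := exp (2 * Rabs B)).
assert (HE : 1 <= E).
{ unfold E; pose proof (exp_ineq1_le (2 * Rabs B)); pose proof (Rabs_pos B); lra. }
exists ((E - 1) / (E + 1)).
assert (Hk : (E - 1) / (E + 1) = 1 - 2 * / (E + 1)) by (field; lra).
assert (Hinv : 0 < / (E + 1) <= / 2).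
{ split; [apply Rinv_0_lt_compat; lra|apply Rinv_le_contravar; lra]. }
split; [lra|].
intros z w Hz Hw H; apply Rnot_lt_le; intros Hlt.
apply artanh_increasing in Hlt; [|lra|now apply Cmod_mobius_lt_1].
change (artanh (Cmod (mobius z w))) with (hyp_dist z w) in Hlt.
replace (artanh ((E - 1) / (E + 1))) with (Rabs B) in Hlt.
- pose proof (Rle_abs B); lra.
- unfold artanh; replace ((1 + (E - 1) / (E + 1)) / (1 - (E - 1) / (E + 1))) with E
    by (field; lra).
  unfold E; rewrite ln_exp; lra.
Qed.

Lemma geodesic_in_disc (tau p : C) :
  Cmod tau = 1 -> geodesic tau p -> unit_disc p.
Proof.
intros Htau (r & Hr & ->); unfold unit_disc.
rewrite Cmod_mult, Cmod_R, Htau, Rmult_1_r; apply Rabs_lt_between; lra.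
Qed.

(** With a = Re (conj tau z) and m = |z|^2, the pseudo-hyperbolic distance from
    z to r tau is governed by the quotient (1 - r^2) / (1 - 2 a r + m r^2). Write
    D r for the denominator. The critical point r0 of the quotient is the root
    in (-1, 1) of a r^2 - (1 + m) r + a, and
    (1 - r0^2) D r - (1 - r^2) D r0 = (1 + m - 2 a r0) (r - r0)^2, which is
    positive for r <> r0. *)
Lemma closest_on_geodesic_unique (tau z : C) :
  Cmod tau = 1 -> unit_disc z -> exists! p, closest_on_geodesic tau z p.
Proof.
intros Htau Hz.
set (a := Re tau * Re z + Im tau * Im z).
set (m := Cmod z ^ 2).
assert (Htau2 : Re tau * Re tau + Im tau * Im tau = 1)
  by (rewrite <- Cmod_sq, Htau; ring).
assert (Hm : 0 <= m < 1) by (unfold m, unit_disc in *; pose proof (Cmod_ge_0 z); nra).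
assert (Ham : a * a <= m).
{ assert (E : m - a * a = (Re tau * Im z - Im tau * Re z) ^ 2).
  { unfold m, a; rewrite Cmod_sq.
    replace (Re z * Re z + Im z * Im z) with
      ((Re tau * Re tau + Im tau * Im tau) * (Re z * Re z + Im z * Im z))
      by (rewrite Htau2; ring).
    ring. }
  pose proof (pow2_ge_0 (Re tau * Im z - Im tau * Re z)); lra. }
set (D := fun r => 1 - 2 * a * r + m * r ^ 2).
assert (HD : forall r, Cmod (1 - Cconj z * (RtoC r * tau)) ^ 2 = D r).
{ intros r; unfold D, m, a; rewrite !Cmod_sq.
  replace ((Re z * Re z + Im z * Im z) * r ^ 2) with
    ((Re tau * Re tau + Im tau * Im tau) * (Re z * Re z + Im z * Im z) * r ^ 2)
    by (rewrite Htau2; ring).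
  destruct tau, z; simpl; ring. }
assert (Hgeo : forall r, -1 < r < 1 -> geodesic tau (RtoC r * tau)%C)
  by (intros r Hr; now exists r).
assert (HDpos : forall r, -1 < r < 1 -> 0 < D r).
{ intros r Hr; rewrite <- HD; apply pow_lt, Cmod_one_minus_conj_gt0; trivial.
  now apply (geodesic_in_disc tau), Hgeo. }
assert (Hrho : forall r, -1 < r < 1 ->
  1 - Cmod (mobius z (RtoC r * tau)) ^ 2 = (1 - m) * (1 - r ^ 2) / D r).
{ intros r Hr; rewrite one_minus_Cmod_mobius_sq; trivial.
  - rewrite HD, Cmod_mult, Cmod_R, Htau, Rmult_1_r, pow2_abs; reflexivity.
  - now apply (geodesic_in_disc tau), Hgeo. }
(* The root in (-1, 1), written so as to cover the case a = 0. *)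
set (s := sqrt ((1 + m) ^ 2 - 4 * (a * a))).
assert (Hs2 : s * s = (1 + m) ^ 2 - 4 * (a * a)) by (apply sqrt_sqrt; nra).
assert (Hs : 0 <= s) by apply sqrt_pos.
set (r0 := 2 * a / (1 + m + s)).
assert (Ha : -(1 + m) < 2 * a < 1 + m) by (split; nra).
assert (Er0 : r0 * (1 + m + s) = 2 * a) by (unfold r0; field; lra).
assert (Hr0 : -1 < r0 < 1) by (split; nra).
assert (Hroot : a * r0 ^ 2 - (1 + m) * r0 + a = 0).
{ assert (E : (a * r0 ^ 2 - (1 + m) * r0 + a) * (1 + m + s) ^ 2 =
    a * (r0 * (1 + m + s)) ^ 2 - (1 + m) * (r0 * (1 + m + s)) * (1 + m + s)
    + a * (1 + m + s) ^ 2) by ring.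
  rewrite Er0 in E.
  assert (E2 : (a * r0 ^ 2 - (1 + m) * r0 + a) * (1 + m + s) ^ 2 =
    a * (s * s - ((1 + m) ^ 2 - 4 * (a * a)))) by (rewrite E; ring).
  rewrite Hs2, Rminus_diag, Rmult_0_r in E2.
  apply Rmult_integral in E2; destruct E2 as [E2|E2]; trivial.
  exfalso; revert E2; apply pow_nonzero; lra. }
assert (Hstrict : forall r, -1 < r < 1 -> r <> r0 ->
  hyp_dist z (RtoC r0 * tau) < hyp_dist z (RtoC r * tau)).
{ intros r Hr Hne; apply (artanh_increasing (Cmod (mobius z (RtoC r0 * tau)))).
  - pose proof (Cmod_ge_0 (mobius z (RtoC r0 * tau))); lra.
  - pose proof (Hrho r Hr) as E1; pose proof (Hrho r0 Hr0) as E2.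
    assert (Hcmp : (1 - r0 ^ 2) * D r - (1 - r ^ 2) * D r0
                   = (1 + m - 2 * a * r0) * (r - r0) ^ 2
                     + (a * r0 ^ 2 - (1 + m) * r0 + a) * (2 * r0 - 2 * r)).
    { unfold D; ring. }
    rewrite Hroot, Rmult_0_l, Rplus_0_r in Hcmp.
    assert (0 < (1 + m - 2 * a * r0) * (r - r0) ^ 2).
    { apply Rmult_lt_0_compat; [nra|].
      assert (r - r0 <> 0) by lra; nra. }
    pose proof (HDpos r Hr); pose proof (HDpos r0 Hr0).
    assert ((1 - m) * (1 - r ^ 2) / D r < (1 - m) * (1 - r0 ^ 2) / D r0).
    { apply (Rmult_lt_reg_r (D r * D r0)); [now apply Rmult_lt_0_compat|].
      replace ((1 - m) * (1 - r ^ 2) / D r * (D r * D r0))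
        with ((1 - m) * ((1 - r ^ 2) * D r0)) by (field; lra).
      replace ((1 - m) * (1 - r0 ^ 2) / D r0 * (D r * D r0))
        with ((1 - m) * ((1 - r0 ^ 2) * D r)) by (field; lra).
      apply Rmult_lt_compat_l; lra. }
    pose proof (Cmod_ge_0 (mobius z (RtoC r0 * tau))).
    pose proof (Cmod_ge_0 (mobius z (RtoC r * tau))).
    nra.
  - apply Cmod_mobius_lt_1; trivial; now apply (geodesic_in_disc tau), Hgeo. }
exists (RtoC r0 * tau)%C; split.
- split; [now apply Hgeo|].
  intros q (r & Hr & ->); destruct (Req_dec r r0) as [->|Hne]; [lra|].
  left; now apply Hstrict.
- intros p [(r & Hr & ->) Hmin].
  destruct (Req_dec r r0) as [->|Hne]; trivial.
  pose proof (Hmin _ (Hgeo r0 Hr0)); pose proof (Hstrict r Hr Hne); lra.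
Qed.

Lemma geodesic_proj_closest (tau z : C) :
  Cmod tau = 1 -> unit_disc z ->
  closest_on_geodesic tau z (geodesic_proj tau z).
Proof.
intros Htau Hz.
exact (iota_correct (V := C_CompleteNormedModule) _
         (closest_on_geodesic_unique tau z Htau Hz)).
Qed.

(** In a Stolz region the point |z| tau is at bounded distance from z. *)
Lemma stolz_dist_proj_bounded (tau z : C) (M : R) :
  Cmod tau = 1 -> unit_disc z -> 0 <= M ->
  Cmod (tau - z) <= M * (1 - Cmod z) ->
  hyp_dist z (geodesic_proj tau z) <= artanh (1 - / (2 * (M + 3) ^ 2)).
Proof.
intros Htau Hz HM0 HM; unfold unit_disc in Hz.
pose proof (Cmod_ge_0 z) as Hz0.
set (p := (RtoC (Cmod z) * tau)%C).
assert (Hp : geodesic tau p) by (exists (Cmod z); split; [lra|reflexivity]).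
destruct (geodesic_proj_closest tau z Htau Hz) as [_ Hmin].
eapply Rle_trans; [apply (Hmin p Hp)|].
assert (HM3 : 9 <= (M + 3) ^ 2) by nra.
assert (Hinv : 0 < / (2 * (M + 3) ^ 2) <= / 18).
{ split; [apply Rinv_0_lt_compat; lra|apply Rinv_le_contravar; lra]. }
apply hyp_dist_le_artanh; [lra|].
assert (Dp : unit_disc p) by now apply (geodesic_in_disc tau).
assert (Ep : Cmod p = Cmod z)
  by (unfold p; rewrite Cmod_mult, Cmod_R, Htau, Rabs_pos_eq; lra).
assert (Hzp : Cmod (z - p) <= (M + 1) * (1 - Cmod z)).
{ replace (z - p)%C with (- (tau - z) + RtoC (1 - Cmod z) * tau)%C
    by (unfold p; rewrite RtoC_minus; ring).
  eapply Rle_trans; [apply Cmod_triangle|].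
  rewrite Cmod_opp, Cmod_mult, Cmod_R, Htau, Rabs_pos_eq by lra; lra. }
pose proof (Cmod_triangle (1 - Cconj z * z) (Cconj z * (z - p))) as T.
replace (1 - Cconj z * z + Cconj z * (z - p))%C with (1 - Cconj z * p)%C in T by ring.
replace (1 - Cconj z * z)%C with (RtoC (1 - Cmod z ^ 2)) in T
  by (rewrite Cmod_sq; destruct z; apply injective_projections; simpl; ring).
rewrite Cmod_R, Rabs_pos_eq, Cmod_mult, Cmod_conj in T by nra.
pose proof (Cmod_one_minus_conj_gt0 z p Hz Dp) as HN0.
pose proof (one_minus_Cmod_mobius_sq z p Hz Dp) as E; rewrite Ep in E.
set (N := Cmod (1 - Cconj z * p)) in *.
pose proof (Cmod_ge_0 (z - p)).
assert (HN : N <= (M + 3) * (1 - Cmod z)) by nra.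
assert (HN2 : N ^ 2 <= (M + 3) ^ 2 * (1 - Cmod z) ^ 2).
{ rewrite <- Rpow_mult_distr; apply pow_incr; lra. }
assert (Hlow : / (M + 3) ^ 2 <= 1 - Cmod (mobius z p) ^ 2).
{ rewrite E; apply (Rmult_le_reg_r ((M + 3) ^ 2 * N ^ 2)).
  - apply Rmult_lt_0_compat; [lra|now apply pow_lt].
  - replace (/ (M + 3) ^ 2 * ((M + 3) ^ 2 * N ^ 2)) with (N ^ 2) by (field; lra).
    replace ((1 - Cmod z ^ 2) * (1 - Cmod z ^ 2) / N ^ 2 * ((M + 3) ^ 2 * N ^ 2))
      with ((M + 3) ^ 2 * (1 - Cmod z ^ 2) ^ 2) by (field; lra).
    eapply Rle_trans; [exact HN2|].
    apply Rmult_le_compat_l; [lra|].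
    apply pow_incr; nra. }
rewrite Rinv_mult in Hinv |- *.
set (e := / (M + 3) ^ 2) in *.
(* (1 - e / 2)^2 >= 1 - e *)
pose proof (Cmod_ge_0 (mobius z p)).
apply Rnot_lt_le; intros Hlt.
assert ((1 - / 2 * e) ^ 2 < Cmod (mobius z p) ^ 2).
{ nra. }
nra.
Qed.

(** Close to tau, points at bounded distance from the geodesic lie in a Stolz
    region. *)
Lemma dist_proj_bounded_stolz (tau : C) (B : R) :
  Cmod tau = 1 ->
  exists M delta, 0 < delta /\ forall z, unit_disc z -> Cmod (tau - z) < delta ->
    hyp_dist z (geodesic_proj tau z) <= B -> Cmod (tau - z) <= M * (1 - Cmod z).
Proof.
intros Htau; destruct (hyp_dist_bounded_mobius B) as (k & Hk & HB).
set (K := 2 / (1 - k)).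
assert (HK : 0 < K) by (apply Rdiv_lt_0_compat; lra).
exists ((1 + K) * K), (/ (1 + K)); split; [apply Rinv_0_lt_compat; lra|].
intros z Hz Hd Hz_B.
destruct (geodesic_proj_closest tau z Htau Hz) as [Hp _].
set (p := geodesic_proj tau z) in *.
assert (Dp : unit_disc p) by now apply (geodesic_in_disc tau).
pose proof (HB z p Hz Dp Hz_B) as Hrho.
destruct (mobius_bounded_comparison k z p Hk Hz Dp Hrho) as [_ Hzp]; fold K in Hzp.
rewrite Cmod_mobius_sym in Hrho by trivial.
apply (nontangential_transfer tau p z k 1); trivial.
destruct Hp as (r & Hr & Ep).
assert (Etp : Cmod (tau - p) = 1 - r).
{ rewrite Ep; replace (tau - RtoC r * tau)%C with (RtoC (1 - r) * tau)%C
    by (rewrite RtoC_minus; ring).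
  rewrite Cmod_mult, Cmod_R, Htau, Rabs_pos_eq; lra. }
assert (Hr0 : 0 <= r).
{ apply Rnot_lt_le; intros Hneg.
  pose proof (Cmod_triangle (tau - z) (z - p)) as T.
  replace (tau - z + (z - p))%C with (tau - p)%C in T by ring.
  pose proof (Cmod_triangle (tau - z) z) as T2.
  replace (tau - z + z)%C with tau in T2 by ring.
  apply (Rmult_lt_compat_l (1 + K)) in Hd; [|lra].
  rewrite Rinv_r in Hd by lra.
  nra. }
rewrite Etp, Ep, Cmod_mult, Cmod_R, Htau, Rabs_pos_eq; lra.
Qed.

(** * The tangential speed *)

Lemma LimSup_p_infty_finite_iff (f : R -> R) :
  Rbar_lt (LimSup_p_infty f) p_infty <->
  exists B, Rbar_locally p_infty (fun t => f t <= B).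
Proof.
unfold LimSup_p_infty.
set (E := fun y => exists T : R, y = Lub_Rbar (fun x => exists t, T <= t /\ x = f t)).
destruct (proj2_sig (Rbar_ex_glb E)) as [Hlow Hglb]; fold (Rbar_glb E) in Hlow, Hglb.
split.
- intros Hlt.
  assert (H : exists T : R,
    Rbar_lt (Lub_Rbar (fun x => exists t, T <= t /\ x = f t)) p_infty).
  { apply NNPP; intros Hno.
    apply (Rbar_lt_not_le _ _ Hlt), Hglb; intros y [T ->].
    apply Rbar_not_lt_le; intros Hy; apply Hno; now exists T. }
  destruct H as [T HT].
  set (S := fun x => exists t, T <= t /\ x = f t) in *.
  destruct (Lub_Rbar_correct S) as [Hub _].
  assert (Hf : forall t, T <= t -> Rbar_le (f t) (Lub_Rbar S))
    by (intros t Ht; apply Hub; now exists t).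
  destruct (Lub_Rbar S) as [B| |].
  + exists B, T; intros t Ht; apply Hf; lra.
  + destruct HT.
  + destruct (Hf T (Rle_refl T)).
- intros (B & T & HB).
  apply Rbar_le_lt_trans with (Lub_Rbar (fun x => exists t, T + 1 <= t /\ x = f t)).
  + apply Hlow; now exists (T + 1).
  + apply Rbar_le_lt_trans with (Finite B); [|exact I].
    apply Lub_Rbar_correct; intros x (t & Ht & ->); apply HB; lra.
Qed.

Lemma Denjoy_Wolff_point_near (phi : R -> C -> C) (tau z : C) (delta : R) :
  Denjoy_Wolff_point phi tau -> unit_disc z -> 0 < delta ->
  Rbar_locally p_infty (fun t => Cmod (tau - phi t z) < delta).
Proof.
intros [_ H] Hz Hd.
assert (Hs : 0 < sqrt 2) by (apply sqrt_lt_R0; lra).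
assert (He : 0 < delta / sqrt 2) by now apply Rdiv_lt_0_compat.
apply (H z Hz (fun w => Cmod (tau - w) < delta)).
exists (mkposreal _ He); intros w Hw.
pose proof (C_NormedModule_mixin_compat2 tau w (mkposreal _ He) Hw) as K.
simpl in K; replace (sqrt 2 * (delta / sqrt 2)) with delta in K by (field; lra).
rewrite Cmod_minus_sym; exact K.
Qed.

Lemma Rbar_locally_p_infty_nonneg : Rbar_locally p_infty (fun t => 0 <= t).
Proof. exists 0; intros t Ht; lra. Qed.

(** Convergence to the Denjoy-Wolff point being granted, only the bound on the
    quotient is at stake. *)
Lemma orbit_non_tangential_iff (phi : R -> C -> C) (tau z : C) :
  non_elliptic_semigroup phi -> Denjoy_Wolff_point phi tau -> unit_disc z ->
  (converges_non_tangentially (fun t => phi t z) tau <->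
   exists M, Rbar_locally p_infty
     (fun t => Cmod (tau - phi t z) <= M * (1 - Cmod (phi t z)))).
Proof.
intros Hphi Htau Hz.
assert (Hiff : forall M t, 0 <= t ->
  (Cmod (tau - phi t z) / (1 - Cmod (phi t z)) <= M <->
   Cmod (tau - phi t z) <= M * (1 - Cmod (phi t z)))).
{ intros M t Ht.
  destruct (sg_holomorphic _ Hphi t Ht z Hz) as [Hd _]; unfold unit_disc in Hd.
  rewrite <- Rle_div_l by lra; tauto. }
split.
- intros [_ [M HM]]; exists M.
  generalize (filter_and _ _ HM Rbar_locally_p_infty_nonneg).
  apply filter_imp; intros t [H Ht]; now apply Hiff.
- intros [M HM]; split; [now apply Htau|]; exists M.
  generalize (filter_and _ _ HM Rbar_locally_p_infty_nonneg).
  apply filter_imp; intros t [H Ht]; now apply Hiff.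
Qed.

(** By Schwarz-Pick, the orbits of z and 0 stay at pseudo-hyperbolic distance at
    most |z|. *)
Lemma non_tangential_iff_orbit_0 (phi : R -> C -> C) (tau z : C) :
  non_elliptic_semigroup phi -> Denjoy_Wolff_point phi tau -> unit_disc z ->
  (converges_non_tangentially (fun t => phi t z) tau <->
   converges_non_tangentially (fun t => phi t 0) tau).
Proof.
intros Hphi Htau Hz.
assert (D0 : unit_disc 0) by (unfold unit_disc; rewrite Cmod_0; lra).
rewrite (orbit_non_tangential_iff phi tau z), (orbit_non_tangential_iff phi tau 0)
  by trivial.
assert (Hd : forall t, 0 <= t -> unit_disc (phi t 0) /\ unit_disc (phi t z) /\
  Cmod (mobius (phi t 0) (phi t z)) <= Cmod z).
{ intros t Ht; pose proof (sg_holomorphic _ Hphi t Ht) as Hhol.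
  repeat split; [now apply Hhol|now apply Hhol|now apply schwarz_pick]. }
split; intros [M HM]; exists ((M + 2 / (1 - Cmod z)) * (2 / (1 - Cmod z)));
  generalize (filter_and _ _ HM Rbar_locally_p_infty_nonneg);
  apply filter_imp; intros t [H Ht]; destruct (Hd t Ht) as (D1 & D2 & H12).
- apply (nontangential_transfer tau (phi t z)); trivial.
  now rewrite Cmod_mobius_sym.
- now apply (nontangential_transfer tau (phi t 0)).
Qed.

Lemma non_tangential_iff_tangential_speed (phi : R -> C -> C) (tau : C) :
  non_elliptic_semigroup phi -> Denjoy_Wolff_point phi tau ->
  (converges_non_tangentially (fun t => phi t 0) tau <->
   Rbar_lt (LimSup_p_infty (tangential_speed phi tau)) p_infty).
Proof.
intros Hphi Htau; pose proof (proj1 Htau) as Htau1.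
assert (D0 : unit_disc 0) by (unfold unit_disc; rewrite Cmod_0; lra).
rewrite orbit_non_tangential_iff, LimSup_p_infty_finite_iff by trivial.
assert (Hd : forall t, 0 <= t -> unit_disc (phi t 0))
  by (intros t Ht; now apply (sg_holomorphic _ Hphi t Ht)).
unfold tangential_speed; split.
- intros [M HM].
  exists (artanh (1 - / (2 * (Rmax 0 M + 3) ^ 2))).
  generalize (filter_and _ _ HM Rbar_locally_p_infty_nonneg).
  apply filter_imp; intros t [H Ht].
  apply stolz_dist_proj_bounded; [trivial|now apply Hd|apply Rmax_l|].
  eapply Rle_trans; [exact H|]; apply Rmult_le_compat_r; [|apply Rmax_r].
  specialize (Hd t Ht); unfold unit_disc in Hd; lra.
- intros [B HB].
  destruct (dist_proj_bounded_stolz tau B Htau1) as (M & delta & Hdelta & HM).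
  exists M.
  pose proof (Denjoy_Wolff_point_near phi tau 0 delta Htau D0 Hdelta) as Hnear.
  generalize (filter_and _ _ Hnear (filter_and _ _ HB Rbar_locally_p_infty_nonneg)).
  apply filter_imp; intros t (H1 & H2 & Ht).
  apply HM; trivial; now apply Hd.
Qed.

Theorem mainTheorem4
  (phi : R -> C -> C) (tau : C)
  (Hphi : non_elliptic_semigroup phi)
  (Htau : Denjoy_Wolff_point phi tau) :
  ((exists z : C, unit_disc z /\
      converges_non_tangentially (fun t => phi t z) tau)
    <-> Rbar_lt (LimSup_p_infty (tangential_speed phi tau)) p_infty)
  /\
  ((forall z : C, unit_disc z ->
      converges_non_tangentially (fun t => phi t z) tau)
    <-> Rbar_lt (LimSup_p_infty (tangential_speed phi tau)) p_infty).
Proof.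
assert (D0 : unit_disc 0) by (unfold unit_disc; rewrite Cmod_0; lra).
rewrite <- (non_tangential_iff_tangential_speed phi tau Hphi Htau).
split; split.
- intros (z & Hz & H).
  now apply (non_tangential_iff_orbit_0 phi tau z Hphi Htau Hz).
- intros H; now exists 0%C.
- intros H; now apply H.
- intros H z Hz; now apply (non_tangential_iff_orbit_0 phi tau z Hphi Htau Hz).
Qed.
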